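(* Let $G$ be a finite group and $H\in L(G)$. Then \[ \varphi_2(H)=\frac{\deg_{\mathcal{B}(G)}(H)}{|H|^2}. \]
   Context: For a group $G$, let $L(G)$ be the set of all subgroups of $G$. The graph $\mathcal{B}(G)$ is the simple undirected bipartite graph with vertex set the disjoint union $V(\mathcal{B}(G)) = (G\times G) \sqcup L(G)$, in which $(a,b)\in G\times G$ and $H \in L(G)$ are adjacent if and only if $H = \langle a,b\rangle$, and there are no other edges; $\deg_{\mathcal{B}(G)}(H)$ is the degree of the vertex $H$. For a finite group $H$, $\varphi_2(H)=\dfrac{|\{(a,b)\in H\times H:\langle a,b\rangle=H\}|}{|H|^2}$ is the probability that a randomly chosen pair of elements of $H$ generates $H$. *)

(* Defs.v *)
From mathcomp Require Import all_boot all_order all_algebra all_fingroup.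

Set Implicit Arguments.
Unset Strict Implicit.
Unset Printing Implicit Defensive.

(* Finite simple graphs whose vertex set is a subset of an ambient finite type. *)
Record sgraph (T : finType) := SGraph {
  verts : {set T};
  adj : rel T;
  adj_sym : symmetric adj;
  adj_irr : irreflexive adj;
  adj_verts : forall u v, adj u v -> u \in verts
}.

Definition degree (T : finType) (X : sgraph T) (v : T) : nat :=
  #|[set u in verts X | adj X v u]|.

Section GeneratingGraph.
Variables (gT : finGroupType) (G : {group gT}).
Local Open Scope group_scope.

Local Notation vertex := ((gT * gT) + {group gT})%type.

Definition Bverts : {set vertex} :=
  [set inl p | p in setX G G] :|: [set inr K | K in subgroups G].

Definition generates (p : gT * gT) (K : {group gT}) : bool :=
  K == <<[set p.1; p.2]>> :> {set gT}.

Definition Badj : rel vertex := fun u v =>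
  [&& u \in Bverts, v \in Bverts &
    match u, v with
    | inl p, inr K | inr K, inl p => generates p K
    | _, _ => false
    end].

Lemma Badj_sym : symmetric Badj.
Proof. by move=> [p|K] [q|L]; rewrite /Badj andbCA. Qed.

Lemma Badj_irr : irreflexive Badj.
Proof. by move=> [p|K]; rewrite /Badj !andbF. Qed.

Lemma Badj_verts u v : Badj u v -> u \in Bverts.
Proof. by case/and3P. Qed.

Definition Bgraph : sgraph vertex := SGraph Badj_sym Badj_irr Badj_verts.

End GeneratingGraph.

Definition phi2 (gT : finGroupType) (H : {group gT}) : rat :=
  (#|[set p in setX H H | generates p H]|%:R / (#|H| ^ 2)%:R)%R.

(* Main.v *)
Require Import Defs.
From mathcomp Require Import all_boot all_order all_algebra all_fingroup.

(** The neighbours of the vertex [H] are exactly the pairs that generate [H]. Such a pair lies in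
    [H * H], hence in [G * G] as [H] is a subgroup of [G], so counting in the graph of [G] or inside
    [H] gives the same number ([degree_Bgraph_inr]). That number is the numerator of [phi2 H]. *)

Lemma inl_inj {A B : Type} : injective (@inl A B).
Proof. by move=> a b []. Qed.

Lemma inr_inj {A B : Type} : injective (@inr A B).
Proof. by move=> a b []. Qed.

Lemma generates_mem {gT : finGroupType} {H : {group gT}} {p : gT * gT} :
  generates p H -> p \in setX H H.
Proof.
move=> /eqP genH; rewrite inE genH.
by apply/andP; split; apply: mem_gen; rewrite !inE eqxx ?orbT.
Qed.

Lemma inl_in_Bverts (gT : finGroupType) (G : {group gT}) (p : gT * gT) :
  (inl p \in Bverts G) = (p \in setX G G).
Proof.
rewrite in_setU (mem_imset _ _ inl_inj); case: imsetP => [[]|] //.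
by rewrite orbF.
Qed.

Lemma inr_in_Bverts (gT : finGroupType) (G K : {group gT}) :
  (inr K \in Bverts G) = (K \in subgroups G).
Proof. by rewrite in_setU (mem_imset _ _ inr_inj); case: imsetP => [[]|]. Qed.

(** The vertex conditions in [Badj] come for free: a pair generating [H] has its entries in [H],
    hence in [G]. *)
Lemma Badj_inr_inl (gT : finGroupType) (G H : {group gT}) (p : gT * gT) :
  H \in subgroups G -> Badj G (inr H) (inl p) = generates p H.
Proof.
move=> HG; rewrite /Badj inr_in_Bverts HG inl_in_Bverts /=.
apply/andb_idl => /generates_mem; apply/subsetP.
by move: HG; rewrite inE => sHG; apply: setXS.
Qed.

(** The neighbourhood is the image under the injection [inl] of the set of generating pairs; no
    subgroup is adjacent to a subgroup. *)
Lemma degree_Bgraph_inr (gT : finGroupType) (G H : {group gT}) :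
  H \in subgroups G ->
  degree (Bgraph G) (inr H) = #|[set p in setX H H | generates p H]|.
Proof.
move=> HG; rewrite -[RHS](card_imset _ (@inl_inj _ {group gT})).
apply: eq_card => -[p|K].
  rewrite (mem_imset _ _ inl_inj) in_set [RHS]in_set /= Badj_inr_inl //.
  rewrite (andb_idl generates_mem); apply: andb_idl.
  (* Read generation as adjacency again: endpoints of edges are vertices. *)
  by rewrite -(Badj_inr_inl _ _ _ _ HG) Badj_sym; apply: Badj_verts.
by rewrite in_set /= /Badj !andbF; case: imsetP => [[]|].
Qed.

Theorem theorem3p3 (gT : finGroupType) (G H : {group gT})
  (HG : H \in subgroups G) :
  phi2 H = ((degree (Bgraph G) (inr H))%:R / (#|H| ^ 2)%:R)%R.
Proof. by rewrite /phi2 degree_Bgraph_inr. Qed.
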